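(* There exists an absolute constant $\delta_0>0$ such that the following holds for every $\epsilon\in(0,10^{-8})$ and every sufficiently large $n$. If $\mathcal{H}$ is a $\mathcal{D}$-free $3$-graph on $n$ vertices with $|\partial\mathcal{H}|=(1/3+\epsilon)n^2$, then $|\mathcal{H}|\le(1/27-\delta_0)n^3$.
   Context: A $3$-graph is a finite vertex set with a set of $3$-element subsets (edges). The shadow is $\partial\mathcal{H}=\{A\in\binom{V(\mathcal{H})}{2}: A\subset B\text{ for some }B\in\mathcal{H}\}$. $\mathcal{K}_4^3$ is the collection of all $3$-graphs $F$ with at most $6$ edges such that for some $4$-set $S$ every pair of vertices of $S$ is contained in some edge of $F$. For $n\ge4$ and a fixed $u\in[n]$, $\mathcal{S}_n$ is the $3$-graph on $[n]$ whose edges are all triples $\{u,v,w\}$ with $\{v,w\}\subset[n]\setminus\{u\}$. $\mathcal{D}$ is the collection of all $F\in\mathcal{K}_4^3$ such that $F$ is not a subgraph of $\mathcal{S}_n$ for any $n\ge4$. $\mathcal{H}$ is $\mathcal{D}$-free if it contains no member of $\mathcal{D}$ as a (not necessarily induced) subgraph. *)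

(* Defs.v *)
From HB Require Import structures.
From mathcomp Require Import all_boot all_order all_algebra.
From mathcomp Require Import reals.

Set Implicit Arguments.
Unset Strict Implicit.
Unset Printing Implicit Defensive.

Import Order.TTheory GRing.Theory Num.Theory.

Record three_graph (V : finType) := ThreeGraph {
  edges :> {set {set V}};
  edge_card : forall e, e \in edges -> #|e| = 3
}.

Definition shadow (V : finType) (H : three_graph V) : {set {set V}} :=
  [set A : {set V} | (#|A| == 2) && [exists B in H, A \subset B]].

(* Vertex sets are arbitrary finite types, so "F is a subgraph of H" means that
   H contains a (not necessarily induced) copy of F. *)
Definition subgraph (U V : finType) (F : three_graph U) (H : three_graph V) :
    Prop :=
  exists f : U -> V,
    injective f /\ forall e : {set U}, e \in edges F -> f @: e \in edges H.

Definition in_K43 (U : finType) (F : three_graph U) : Prop :=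
  #|edges F| <= 6 /\
  exists S : {set U}, #|S| = 4 /\
    forall x y : U, x \in S -> y \in S -> x != y ->
      exists e : {set U}, [/\ e \in edges F, x \in e & y \in e].

Definition star_edges (n : nat) (u : 'I_n) : {set {set 'I_n}} :=
  [set u |: A | A in [set A : {set 'I_n} | (A \subset ~: [set u]) && (#|A| == 2)]].

Lemma star_edge_card (n : nat) (u : 'I_n) (e : {set 'I_n}) :
  e \in star_edges u -> #|e| = 3.
Proof.
case/imsetP=> A; rewrite inE subsetC sub1set inE => /andP[uA /eqP cA] ->.
by rewrite cardsU1 uA cA.
Qed.

Definition star (n : nat) (u : 'I_n) : three_graph 'I_n :=
  ThreeGraph (@star_edge_card n u).

(* The choice of the centre u is immaterial: all stars on 'I_n are isomorphic. *)
Definition in_D (U : finType) (F : three_graph U) : Prop :=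
  in_K43 F /\ forall (n : nat) (u : 'I_n), 4 <= n -> ~ subgraph F (star u).

Definition D_free (V : finType) (H : three_graph V) : Prop :=
  forall (U : finType) (F : three_graph U), in_D F -> ~ subgraph F H.

(* Main.v *)
Require Import Defs.
From mathcomp Require Import all_boot all_order all_algebra.
From mathcomp Require Import ring lra zify.
From mathcomp Require Import reals.

Set Implicit Arguments.
Unset Strict Implicit.
Unset Printing Implicit Defensive.

Import Order.TTheory GRing.Theory Num.Theory.

(* In a D-free 3-graph H every 4-clique of the shadow has a centre w such that
   all edges through two clique vertices other than w contain w. Call a pair
   heavy if it lies in at least two edges. Then no shadow neighbourhood
   contains a heavy triangle, and the heavy pairs in the common neighbourhood of
   a shadow pair form a star.

   All but at most n^2 edges of H have only heavy pairs, so if H has nearly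
   n^3/27 edges, the heavy graph, which is K4-free, has nearly the maximum number
   of triangles. Double counting gives a heavy triangle xyz whose pairwise common
   neighbourhoods cover nearly all vertices; these are disjoint independent sets,
   so the heavy graph is nearly complete tripartite on them.

   A vertex of shadow degree at least (16/25)n has few shadow neighbours in one of
   the parts. Classifying these vertices accordingly, a shadow edge inside a
   class would have in its common neighbourhood heavy pairs that do not form a
   star. So the shadow is tripartite on the vertices of high degree, and the few
   others have degree too small to raise the number of pairs above n^2/3. *)

(** * Four-cliques in the shadow of a D-free 3-graph *)

Definition triangle (V : finType) (g : rel V) x y z :=
  [&& g x y, g x z & g y z].

Section DFree.
Variables (V : finType) (H : three_graph V).
Hypothesis Hfree : D_free H.

(** Without a common vertex, E alone would be a member of D: an embedding into a star would pull the
    star's centre back to a vertex common to all edges of E. *)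
Lemma cover_common_vertex (S : {set V}) (E : {set {set V}}) :
  #|S| = 4 -> E \subset edges H -> #|E| <= 6 ->
  (forall x y, x \in S -> y \in S -> x != y ->
     exists e, [/\ e \in E, x \in e & y \in e]) ->
  exists w, forall e, e \in E -> w \in e.
Proof.
move=> cS sE cE cov.
have [/existsP[w /forall_inP hw]|no] :=
  boolP [exists w, [forall e in E, w \in e]]; first by exists w.
pose F := ThreeGraph (fun e (eE : e \in E) => edge_card (subsetP sE e eE)).
suff /Hfree[] : in_D F.
  exists id; split=> [//|e eE]; rewrite imset_id; exact: (subsetP sE).
split; first by split=> //; exists S.
move=> n u _ [f [f_inj hf]]; case/negP: no.
have starP e : e \in E -> u \in f @: e.
  by move=> /hf /imsetP[A _ ->]; rewrite setU11.
have /card_gt1P[x [y [xS yS xy]]] : 1 < #|S| by rewrite cS.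
have [e0 [e0E _ _]] := cov x y xS yS xy.
have /imsetP[w we0 uw] := starP _ e0E.
apply/existsP; exists w; apply/forall_inP => e /starP /imsetP[w' we uw'].
by rewrite (f_inj w w') // -uw.
Qed.

Lemma edge_mem4 (e : {set V}) (a b c d : V) : e \in edges H ->
  uniq [:: a; b; c; d] -> a \in e -> b \in e -> c \in e -> d \in e -> False.
Proof.
move=> /edge_card ce u ae be ce' de.
have : #|[set a; b; c; d]| <= #|e|.
  by apply/subset_leq_card/subsetP => x; rewrite !inE -!orbA =>
    /or4P[] /eqP->.
by rewrite ce cardE (@perm_size _ _ [:: a; b; c; d]) // uniq_perm ?enum_uniq //
   => x; rewrite mem_enum !inE -!orbA.
Qed.

(** The six edges may coincide, so that one edge can serve several pairs. *)
Lemma edges_common_vertex (a b c d : V) (e1 e2 e3 e4 e5 e6 : {set V}) :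
  uniq [:: a; b; c; d] ->
  all (mem (edges H)) [:: e1; e2; e3; e4; e5; e6] ->
  a \in e1 -> b \in e1 -> a \in e2 -> c \in e2 -> a \in e3 -> d \in e3 ->
  b \in e4 -> c \in e4 -> b \in e5 -> d \in e5 -> c \in e6 -> d \in e6 ->
  exists w, all (fun e : {set V} => w \in e) [:: e1; e2; e3; e4; e5; e6].
Proof.
move=> u /allP hE a1 b1 a2 c2 a3 d3 b4 c4 b5 d5 c6 d6.
have [|||x y|w hw] := @cover_common_vertex [set x in [:: a; b; c; d]]
    [set x in [:: e1; e2; e3; e4; e5; e6]].
- by rewrite cardsE; apply/card_uniqP.
- by apply/subsetP => e; rewrite inE => /hE.
- by rewrite cardsE; apply: leq_trans (card_size _) _.
- rewrite !inE => /or4P[] /eqP-> /or4P[] /eqP-> //; rewrite ?eqxx // => _;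
  first [ exists e1; split=> //; rewrite !inE eqxx ?orbT; done
        | exists e2; split=> //; rewrite !inE eqxx ?orbT; done
        | exists e3; split=> //; rewrite !inE eqxx ?orbT; done
        | exists e4; split=> //; rewrite !inE eqxx ?orbT; done
        | exists e5; split=> //; rewrite !inE eqxx ?orbT; done
        | exists e6; split=> //; rewrite !inE eqxx ?orbT; done ].
- by exists w; apply/allP => e he; apply: hw; rewrite inE.
Qed.

(* If the centre w lies in the clique, the edges wxy, wxz, wyz cover it, and an
   edge through x, y that avoids w would be xyz, leaving no common vertex. *)
Lemma center_in_clique (w x y z : V) (exy exz eyz e : {set V}) :
  uniq [:: w; x; y; z] -> all (mem (edges H)) [:: exy; exz; eyz; e] ->
  w \in exy -> x \in exy -> y \in exy ->
  w \in exz -> x \in exz -> z \in exz ->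
  w \in eyz -> y \in eyz -> z \in eyz ->
  x \in e -> y \in e -> w \in e.
Proof.
move=> u /= /and5P[hxy hxz hyz he _] wxy xxy yxy wxz xxz zxz wyz yyz zyz xe ye.
have u1 := u; move: u1; rewrite /= !inE !negb_or -!andbA.
move=> /and5P[wx wy wz xy /and3P[xz yz _]].
have /= [|w2] := @edges_common_vertex w x y z exy exy exz e exz eyz u _
   wxy xxy wxy yxy wxz zxz xe ye xxz zxz yyz zyz.
  by rewrite hxz hyz he hxy.
case/and5P=> g1 _ g2 g3 /and3P[_ g4 _].
have [->//|w2w] := eqVneq w w2.
have [w2x|w2x] := eqVneq w2 x.
  by case: (edge_mem4 hyz u) => //; rewrite -w2x.
have [w2z|w2z] := eqVneq w2 z.
  by case: (edge_mem4 hxy u) => //; rewrite -w2z.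
case: (@edge_mem4 exz w w2 x z hxz) => //.
by rewrite /= !inE !negb_or w2w wx wz w2x w2z xz.
Qed.


(** The five edges other than e are w together with their pair. A vertex common to all six edges, if
    not w, would lie in each of the pairs ac, ad and bc, which have empty intersection. *)
Lemma center_off_clique (w a b c d : V) (eac ead ebc ebd ecd e : {set V}) :
  uniq [:: w; a; b; c; d] -> all (mem (edges H)) [:: eac; ead; ebc; ebd; ecd; e] ->
  a \in eac -> c \in eac -> a \in ead -> d \in ead -> b \in ebc -> c \in ebc ->
  b \in ebd -> d \in ebd -> c \in ecd -> d \in ecd ->
  all (fun e : {set V} => w \in e) [:: eac; ead; ebc; ebd; ecd] ->
  a \in e -> b \in e -> w \in e.
Proof.
move=> u; have /andP[_ u4] := u => /= /and5P[hac had hbc hbd /and3P[hcd he _]].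
move=> aac cac aad dad bbc cbc bbd dbd ccd dcd.
move=> /and5P[wac wad wbc wbd _] ae be.
have /= [|w1] := @edges_common_vertex a b c d e eac ead ebc ebd ecd u4 _
   ae be aac cac aad dad bbc cbc bbd dbd ccd dcd.
  by rewrite hac had hbc hbd hcd he.
case/and5P=> h1 h2 h3 h4 _; have [->//|w1w] := eqVneq w w1.
move: u; rewrite /= !inE !negb_or -!andbA.
move=> /and5P[wa wb wc wd /and5P[ab ac ad bc /and3P[bd cd _]]].
have no (x y : V) (f : {set V}) : f \in edges H -> w \in f -> x \in f ->
    y \in f -> w1 \in f -> w != x -> w != y -> x != y -> (w1 == x) || (w1 == y).
  move=> hf wf xf yf w1f wx wy xy; apply: contraT; rewrite negb_or.
  case/andP=> w1x w1y; case: (@edge_mem4 f w w1 x y hf) => //.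
  by rewrite /= !inE !negb_or w1w wx wy w1x w1y xy.
have := no a c eac hac wac aac cac h2 wa wc ac.
have := no a d ead had wad aad dad h3 wa wd ad.
have := no b c ebc hbc wbc bbc cbc h4 wb wc bc.
case: (eqVneq w1 a) => [->|_] /=; first by rewrite (negPf ab) (negPf ac).
by move=> _ /eqP->; rewrite eq_sym (negPf cd).
Qed.

Lemma clique_center (S : {set V}) : #|S| = 4 ->
  (forall x y, x \in S -> y \in S -> x != y ->
     exists e, [/\ e \in edges H, x \in e & y \in e]) ->
  exists w, forall x y e, x \in S -> y \in S -> x != y -> x != w -> y != w ->
    e \in edges H -> x \in e -> y \in e -> w \in e.
Proof.
move=> cS cl.
have pick2 x y : x \in S -> y \in S -> x != y ->
    exists z t, [/\ z \in S, t \in S & uniq [:: x; y; z; t]].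
  move=> xS yS xy; have : 1 < #|S :\ x :\ y|.
    have := cardsD1 x S; have := cardsD1 y (S :\ x).
    by rewrite cS xS !inE yS eq_sym xy /= !add1n => [] [->] [->].
  case/card_gt1P=> z [t []]; rewrite !inE => /and3P[zy zx zS] /and3P[ty tx tS] zt.
  exists z, t; split=> //.
  by rewrite /= !inE !negb_or xy zt ![x == _]eq_sym ![y == _]eq_sym zx tx zy ty.
(* One chosen edge per pair gives a common vertex w, hence an edge through w over every pair. *)
have [w hw] : exists w, forall x y, x \in S -> y \in S -> x != y ->
    exists e, [/\ e \in edges H, w \in e, x \in e & y \in e].
  have /card_gt1P[a [b [aS bS ab]]] : 1 < #|S| by rewrite cS.
  have [c [d [cS' dS u]]] := pick2 a b aS bS ab.
  have := u; rewrite /= !inE !negb_or -!andbA.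
  move=> /and5P[_ ac ad bc /and3P[bd cd _]].
  have [e1 [h1 a1 b1]] := cl a b aS bS ab.
  have [e2 [h2 a2 c2]] := cl a c aS cS' ac.
  have [e3 [h3 a3 d3]] := cl a d aS dS ad.
  have [e4 [h4 b4 c4]] := cl b c bS cS' bc.
  have [e5 [h5 b5 d5]] := cl b d bS dS bd.
  have [e6 [h6 c6 d6]] := cl c d cS' dS cd.
  have /= [|w] := @edges_common_vertex a b c d e1 e2 e3 e4 e5 e6 u _
    a1 b1 a2 c2 a3 d3 b4 c4 b5 d5 c6 d6; first by rewrite h1 h2 h3 h4 h5 h6.
  move=> /and5P[w1 w2 w3 w4 /and3P[w5 w6 _]].
  exists w => x y; have SE : S = [set x in [:: a; b; c; d]].
    apply/esym/eqP; rewrite eqEcard cS cardsE (card_uniqP u) leqnn andbT.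
    by apply/subsetP => v; rewrite !inE => /or4P[] /eqP->.
  rewrite SE !inE => /or4P[] /eqP-> /or4P[] /eqP-> //; rewrite ?eqxx // => _;
  first [ by exists e1 | by exists e2 | by exists e3 | by exists e4
        | by exists e5 | by exists e6 ].
exists w => x y e xS yS xy xw yw he xe ye.
have [z [t [zS tS u]]] := pick2 x y xS yS xy.
have := u; rewrite /= !inE !negb_or -!andbA.
move=> /and5P[_ xz xt yz /and3P[yt zt _]].
(* As w is neither x nor y, a centre inside S is z or t; both cases reduce to [center_in_clique]. *)
have inS v : v \in S -> v != x -> v != y -> w = v -> w \in e.
  move=> vS vx vy wv; rewrite -{}wv in vS vx vy *.
  have [v' [v'S u3]] : exists v', v' \in S /\ uniq [:: w; x; y; v'].
    have : 0 < #|S :\ x :\ y :\ w|.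
      have := cardsD1 x S; have := cardsD1 y (S :\ x).
      have := cardsD1 w (S :\ x :\ y).
      rewrite !inE yS xS vS vx vy eq_sym xy cS /= !add1n.
      by move=> -> [->] [->].
    case/card_gt0P=> v'; rewrite !inE => /and4P[h1 h2 h3 h4].
    exists v'; split=> //.
    by rewrite /= !inE !negb_or vx vy xy ![_ == v']eq_sym h1 h2 h3.
  have := u3; rewrite /= !inE !negb_or -!andbA.
  move=> /and5P[_ _ wv' _ /and3P[xv' yv' _]].
  have [e1 [f1 g1 k1 l1]] := hw x y xS yS xy.
  have [e2 [f2 g2 k2 l2]] := hw x v' xS v'S xv'.
  have [e3 [f3 g3 k3 l3]] := hw y v' yS v'S yv'.
  apply: (@center_in_clique w x y v' e1 e2 e3 e) => //.
  by rewrite /= f1 f2 f3 he.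
have [wz|wz] := eqVneq w z; first by apply: (inS z); rewrite // eq_sym.
have [wt|wt] := eqVneq w t; first by apply: (inS t); rewrite // eq_sym.
have [e2 [f2 g2 k2 l2]] := hw x z xS zS xz.
have [e3 [f3 g3 k3 l3]] := hw x t xS tS xt.
have [e4 [f4 g4 k4 l4]] := hw y z yS zS yz.
have [e5 [f5 g5 k5 l5]] := hw y t yS tS yt.
have [e6 [f6 g6 k6 l6]] := hw z t zS tS zt.
apply: (@center_off_clique w x y z t e2 e3 e4 e5 e6 e) => //.
- by rewrite cons_uniq u !inE !negb_or ![w == _]eq_sym xw yw ![_ == w]eq_sym wz wt.
- by rewrite /= f2 f3 f4 f5 f6 he.
- by rewrite /= g2 g3 g4 g5 g6.
Qed.

(** * The shadow graph and the heavy graph *)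

Definition shadow_rel : rel V := fun x y =>
  (x != y) && [exists e in edges H, (x \in e) && (y \in e)].

Definition edges_at x y := [set e in edges H | (x \in e) && (y \in e)].

Definition heavy : rel V := fun x y => (x != y) && (1 < #|edges_at x y|).

Lemma shadow_relC : symmetric shadow_rel.
Proof.
move=> x y; rewrite /shadow_rel eq_sym; congr (_ && _).
by apply: eq_existsb => e; rewrite (andbC (x \in e)).
Qed.

Lemma heavyC : symmetric heavy.
Proof.
move=> x y; rewrite /heavy /edges_at eq_sym; congr (_ && (_ < _)).
by apply: eq_card => e; rewrite !inE (andbC (x \in e)).
Qed.

Lemma heavy_shadow : subrel heavy shadow_rel.
Proof.
move=> x y /andP[xy /card_gt1P[e [_ [+ _ _]]]]; rewrite inE => /andP[he xye].
by rewrite /shadow_rel xy; apply/existsP; exists e; rewrite he.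
Qed.

Lemma edge_eq3 (e : {set V}) x y z : e \in edges H ->
  x != y -> x != z -> y != z -> x \in e -> y \in e -> z \in e ->
  e = [set x; y; z].
Proof.
move=> he xy xz yz xe ye ze; apply/esym/eqP; rewrite eqEcard.
apply/andP; split; first by apply/subsetP => v; rewrite !inE -orbA =>
  /or3P[] /eqP->.
by rewrite (edge_card he) setUC cardsU1 !inE negb_or !(eq_sym z) xz yz cards2 xy.
Qed.

(** Every edge through x and y contains w, hence is xyw; so xy lies in at most one edge and is not
    heavy. *)
Lemma shadow_clique_center a b c d :
  shadow_rel a b -> shadow_rel a c -> shadow_rel a d ->
  shadow_rel b c -> shadow_rel b d -> shadow_rel c d ->
  exists w, let s := [:: a; b; c; d] in
  forall x y, x \in s -> y \in s -> x != y -> x != w -> y != w ->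
    (forall e, e \in edges H -> x \in e -> y \in e -> w \in e) /\ ~~ heavy x y.
Proof.
have sym x y : shadow_rel x y -> shadow_rel y x by rewrite shadow_relC.
move=> ab ac ad bc bd cd.
have u : uniq [:: a; b; c; d].
  rewrite /= !inE !negb_or.
  by move: ab ac ad bc bd cd => /andP[-> _] /andP[-> _] /andP[-> _]
    /andP[-> _] /andP[-> _] /andP[-> _].
have [||w hw] := @clique_center [set x in [:: a; b; c; d]].
- by rewrite cardsE; apply/card_uniqP.
- move=> x y xS yS xy.
  suff /andP[_ /exists_inP[e he /andP[xe ye]]] : shadow_rel x y by exists e.
  move: xS yS xy; rewrite !inE => /or4P[] /eqP-> /or4P[] /eqP-> xy;
    by first [exact: sym | rewrite eqxx in xy | assumption].
exists w => /= x y xs ys xy xw yw.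
have h e : e \in edges H -> x \in e -> y \in e -> w \in e.
  by move=> he xe ye; apply: (hw x y e) => //; rewrite inE.
split=> //; apply/negP => /andP[_ /card_gt1P[e [e' []]]].
rewrite !inE => /and3P[he xe ye] /and3P[he' xe' ye'] /eqP[].
by rewrite (edge_eq3 he xy xw yw) ?h // (edge_eq3 he' xy xw yw) ?h.
Qed.

(** The centre of the shadow clique vxyz would have to lie on all three sides of xyz. *)
Lemma no_heavy_triangle v x y z :
  shadow_rel v x -> shadow_rel v y -> shadow_rel v z ->
  triangle heavy x y z -> False.
Proof.
move=> vx vy vz /and3P[hxy hxz hyz].
have [w hw] := shadow_clique_center vx vy vz (heavy_shadow hxy)
  (heavy_shadow hxz) (heavy_shadow hyz).
have mx : x \in [:: v; x; y; z] by rewrite !inE eqxx orbT.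
have my : y \in [:: v; x; y; z] by rewrite !inE eqxx !orbT.
have mz : z \in [:: v; x; y; z] by rewrite !inE eqxx !orbT.
have key p q : p \in [:: v; x; y; z] -> q \in [:: v; x; y; z] -> heavy p q ->
    (p == w) || (q == w).
  move=> mp mq hpq; have /andP[pq _] := hpq; apply: contraT; rewrite negb_or.
  by move=> /andP[pw qw]; have [_ /negP[]] := hw p q mp mq pq pw qw.
have /andP[xy _] := hxy; have /andP[xz _] := hxz; have /andP[yz _] := hyz.
have := key x y mx my hxy; have := key x z mx mz hxz.
have := key y z my mz hyz.
have [xw|_] := eqVneq x w; first by rewrite -xw ![_ == x]eq_sym (negPf xy) (negPf xz).
by move=> _ /= /eqP zw /eqP yw; rewrite zw yw eqxx in yz.
Qed.

(** Take for w the third vertex of one fixed edge over uv, independent of x and y. In the clique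
    uvxy the heavy pair xy must contain the clique centre; the centre then differs from u and v,
    lies in every edge over uv, and so equals w. *)
Lemma heavy_common_star u v : shadow_rel u v -> exists w, forall x y,
  shadow_rel u x -> shadow_rel v x -> shadow_rel u y -> shadow_rel v y ->
  heavy x y -> x = w \/ y = w.
Proof.
move=> uv; have /andP[uv_neq /exists_inP[e he /andP[ue ve]]] := uv.
have [w ew] : exists w, forall x, x \in e -> x != u -> x != v -> x = w.
  have : 0 < #|e :\ u :\ v|.
    have := cardsD1 u e; have := cardsD1 v (e :\ u).
    by rewrite (edge_card he) !inE ue ve eq_sym uv_neq /= !add1n => -> [<-].
  case/card_gt0P=> w; rewrite !inE => /and3P[wv wu we].
  exists w => x xe xu xv.
  have eE : e = [set u; v; w] by apply: edge_eq3 => //; rewrite eq_sym.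
  by move: xe; rewrite eE !inE (negPf xu) (negPf xv) => /eqP.
exists w => x y ux vx uy vy hxy.
have [w' hw] := shadow_clique_center uv ux uy vx vy (heavy_shadow hxy).
have mx : x \in [:: u; v; x; y] by rewrite !inE eqxx !orbT.
have my : y \in [:: u; v; x; y] by rewrite !inE eqxx !orbT.
have mu : u \in [:: u; v; x; y] by rewrite !inE eqxx.
have mv : v \in [:: u; v; x; y] by rewrite !inE eqxx !orbT.
have neq p q : shadow_rel p q -> p != q by case/andP.
have in_e p : shadow_rel u p -> shadow_rel v p -> p = w' -> p = w.
  move=> up vp pw'; have pu := neq _ _ up; have pv := neq _ _ vp.
  apply: ew; rewrite 1?eq_sym //; rewrite pw' in pu pv *.
  by have [h _] := hw u v mu mv uv_neq pu pv; apply: h.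
have [/(in_e _ ux vx)|xw'] := eqVneq x w'; first by left.
have [/(in_e _ uy vy)|yw'] := eqVneq y w'; first by right.
have /andP[xy _] := hxy.
by have [_] := hw x y mx my xy xw' yw'; rewrite hxy.
Qed.

End DFree.

(** Applied to the maps sending ordered pairs (k = 2) and ordered triples (k = 6) to their
    underlying sets. *)
Lemma card_ge_fibers (T U : finType) (f : T -> U) (D : {set T}) (B : {set U})
    (k : nat) :
  (forall u, u \in B -> k <= #|[set t in D | f t == u]|) -> k * #|B| <= #|D|.
Proof.
move=> hk; rewrite mulnC -sum_nat_const -(sum1_card (mem D)).
apply: (@leq_trans (\sum_(t in D | f t \in B) 1)).
  rewrite (partition_big f (mem B)) => [|t /andP[]//].
  apply: leq_sum => u uB; apply: leq_trans (hk u uB) _.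
  rewrite -sum1dep_card; apply/eq_leq/eq_bigl => t.
  by case: eqP => [->|]; rewrite ?uB ?andbT ?andbF.
rewrite [leqRHS]big_mkcond [leqLHS]big_mkcond.
by apply: leq_sum => t _; case: (t \in D); case: (f t \in B).
Qed.

Section Counting.
Variables (V : finType) (H : three_graph V).

Lemma card_shadow_le : 2 * #|shadow H| <= #|[set p | shadow_rel H p.1 p.2]|.
Proof.
apply: (@card_ge_fibers _ _ (fun p => [set p.1; p.2])) => A.
rewrite inE => /andP[/cards2P[x [y [xy ->]]] /exists_inP[e he sub]].
have xyH : shadow_rel H x y.
  rewrite /shadow_rel xy; apply/exists_inP; exists e => //.
  by rewrite !(subsetP sub) // !inE eqxx ?orbT.
have -> : 2 = #|[set (x, y); (y, x)]|.
  by rewrite cards2 xpair_eqE negb_and xy.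
apply/subset_leq_card/subsetP => p; rewrite !inE => /orP[] /eqP-> /=.
  by rewrite xyH eqxx.
by rewrite shadow_relC xyH setUC eqxx.
Qed.

(* An edge with a pair that lies in no other edge is determined by that pair, so
   there are at most n^2 of them; each other edge gives six ordered triangles. *)
Lemma card_edges_le :
  6 * #|edges H| <=
  #|[set p : V * V * V | triangle (heavy H) p.1.1 p.1.2 p.2]| + 6 * #|V| ^ 2.
Proof.
pose light := [set e in edges H |
  [exists p : V * V, [&& p.1 \in e, p.2 \in e, p.1 != p.2 & ~~ heavy H p.1 p.2]]].
pose D := [set p : V * V * V | triangle (heavy H) p.1.1 p.1.2 p.2].
have light_le : #|light| <= #|V| ^ 2.
  have -> : #|V| ^ 2 = #|{: V * V}| by rewrite card_prod mulnn.
  (* A pair of an edge that is not heavy lies in that edge only, so the union of the edges over the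
     pair recovers it. *)
  apply: leq_trans (leq_imset_card
    (fun p : V * V => \bigcup_(e in edges_at H p.1 p.2) e) _).
  apply/subset_leq_card/subsetP => e; rewrite inE.
  case/andP=> he /existsP[[x y] /and4P[/= xe ye xy]].
  rewrite /heavy xy /= -leqNgt => le1; apply/imsetP; exists (x, y) => //=.
  have eat : e \in edges_at H x y by rewrite inE he xe ye.
  rewrite -[LHS](big_set1 (@setU V) e id); apply: eq_bigl => f.
  apply/idP/idP => [|fat]; first by rewrite inE => /eqP->.
  by rewrite inE; apply/eqP/(card_le1_eqP le1).
have heavy_le : 6 * #|edges H :\: light| <= #|D|.
  apply: (@card_ge_fibers _ _ (fun p => [set p.1.1; p.1.2; p.2])) => e.
  rewrite !inE => /andP[+ he]; rewrite he /= negb_exists => /forallP hv.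
  have /card_gt2P[x [y [z [[xe ye ze] [xy yz zx]]]]] : 2 < #|e|.
    by rewrite (edge_card he).
  have xz : x != z by rewrite eq_sym.
  have hvy p q : p \in e -> q \in e -> p != q -> heavy H p q.
    by move=> pe qe pq; have := hv (p, q); rewrite /= pe qe pq /= negbK.
  pose s := [:: (x, y, z); (x, z, y); (y, x, z); (y, z, x); (z, x, y); (z, y, x)].
  have us : uniq s.
    by rewrite /= !inE !xpair_eqE ?eqxx !(eq_sym z) !(eq_sym y x)
      (negPf xy) (negPf xz) (negPf yz) ?andbF.
  have <- : #|[set p in s]| = 6 by rewrite cardsE (card_uniqP us).
  have mem_fiber a b c : a \in e -> b \in e -> c \in e -> a != b -> a != c ->
      b != c -> (a, b, c) \in
      [set p in D | [set p.1.1; p.1.2; p.2] == e].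
    move=> ae be ce ab ac bc; rewrite !inE /triangle /=.
    by rewrite (edge_eq3 he ab ac bc) // eqxx !hvy.
  apply/subset_leq_card/subsetP => p; rewrite inE !in_cons in_nil orbF.
  by do 5?[case/orP=> [/eqP->|]]; last move=> /eqP->;
    apply: mem_fiber => //; rewrite eq_sym.
have : #|edges H| <= #|light| + #|edges H :\: light|.
  by rewrite -(cardsID light (edges H)) leq_add2r subset_leq_card ?subsetIr.
by rewrite -/D; lia.
Qed.
End Counting.

Local Open Scope ring_scope.

(** Leaves to [lra] and [nra] only the inequalities moved back into the goal. *)
Ltac clear_ineqs :=
  repeat match goal with
  | H : is_true (@Order.le _ _ _ _) |- _ => clear H
  | H : is_true (@Order.lt _ _ _ _) |- _ => clear H
  end.

(** * Triangle counts in K4-free graphs *)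

Section TriangleCount.
Variables (R : realFieldType) (V : finType) (g : rel V).
Local Notation n := (@GRing.one R *+ #|V|).

Definition degree x : R := \sum_y (g x y)%:R.
Definition codegree x y : R := \sum_z (g x z && g y z)%:R.
Definition num_arcs : R := \sum_x \sum_y (g x y)%:R.
Definition num_triangles : R := \sum_x \sum_y \sum_z (triangle g x y z)%:R.

Hypothesis gC : symmetric g.
Hypothesis gK4 : forall v x y z,
  g v x -> g v y -> g v z -> triangle g x y z -> False.

Lemma sum1_card_natr : \sum_(x : V) (1 : R) = n.
Proof. by rewrite sumr_const. Qed.

Lemma num_triangles_codegree :
  num_triangles = \sum_x \sum_y (g x y)%:R * codegree x y.
Proof.
apply: eq_bigr => x _; apply: eq_bigr => y _; rewrite big_distrr /=.
by apply: eq_bigr => z _; rewrite -natrM mulnb.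
Qed.

Lemma degreeD_le x y : degree x + degree y <= n + codegree x y.
Proof.
rewrite -sum1_card_natr -!big_split /=; apply: ler_sum => z _.
by case: (g x z); case: (g y z); rewrite /=; lra.
Qed.

(* In a K4-free graph the three common neighbourhoods are disjoint. *)
Lemma codegreeD_le x y z : triangle g x y z ->
  codegree x y + codegree x z + codegree y z <= n.
Proof.
move=> txyz; rewrite -sum1_card_natr -!big_split /=; apply: ler_sum => v _.
have := @gK4 v x y z; rewrite ![g v _]gC.
by case: (g x v); case: (g y v); case: (g z v) => h /=; try lra; case: h.
Qed.

(** An arc extends to a triangle in codegree many ways, and by symmetry it may occupy any two of the
    three positions. *)
Lemma sum_triangle_codegree (f : V -> V -> R) :
  [/\ \sum_x \sum_y \sum_z (triangle g x y z)%:R * f x y =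
        \sum_x \sum_y (g x y)%:R * codegree x y * f x y,
      \sum_x \sum_y \sum_z (triangle g x y z)%:R * f x z =
        \sum_x \sum_y (g x y)%:R * codegree x y * f x y &
      \sum_x \sum_y \sum_z (triangle g x y z)%:R * f y z =
        \sum_x \sum_y (g x y)%:R * codegree x y * f x y].
Proof.
have E x y : (g x y)%:R * codegree x y * f x y =
    \sum_z (triangle g x y z)%:R * f x y.
  rewrite big_distrr big_distrl /=; apply: eq_bigr => z _.
  by rewrite -natrM mulnb.
split.
- by apply: eq_bigr => x _; apply: eq_bigr => y _; rewrite E.
- apply: eq_bigr => x _; rewrite exchange_big; apply: eq_bigr => y _.
  rewrite E; apply: eq_bigr => z _; rewrite /triangle (gC z y).
  by rewrite andbCA.
- rewrite exchange_big; apply: eq_bigr => x _.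
  rewrite exchange_big; apply: eq_bigr => y _.
  rewrite E; apply: eq_bigr => z _; rewrite /triangle ![g z _]gC.
  by rewrite andbA andbC.
Qed.

(** With c the codegree, summing the hypothesis over triangles gives 3 sum c^2 <= M sum c over arcs;
    Cauchy-Schwarz bounds sum c^2 from below. M = n serves Turan's bound, a smaller M the choice of
    a good triangle. *)
Lemma num_triangles_le (M : R) : 0 < M ->
  (forall x y z, triangle g x y z ->
     codegree x y + codegree x z + codegree y z <= M) ->
  3 * num_triangles <= M * num_arcs.
Proof.
move=> M0 hM; have [h1 h2 h3] := sum_triangle_codegree codegree.
pose S : R := \sum_x \sum_y (g x y)%:R * codegree x y * codegree x y.
rewrite -/S in h1 h2 h3.
have up : 3 * S <= M * num_triangles.
  have -> : 3 * S = S + S + S by ring.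
  rewrite -{1}h1 -{1}h2 -{1}h3 -!big_split mulr_sumr; apply: ler_sum => x _.
  rewrite -!big_split mulr_sumr; apply: ler_sum => y _.
  rewrite -!big_split mulr_sumr; apply: ler_sum => z _ /=.
  have := hM x y z; case: (triangle g x y z) => [/(_ isT)|_] /=; lra.
(* Cauchy-Schwarz, linearised around the value M / 3 expected of c(x,y). *)
have low : 2 * (M / 3) * num_triangles - (M / 3) ^+ 2 * num_arcs <= S.
  rewrite num_triangles_codegree !mulr_sumr -sumrB; apply: ler_sum => x _.
  rewrite !mulr_sumr -sumrB; apply: ler_sum => y _.
  have := sqr_ge0 (codegree x y - M / 3).
  by case: (g x y); rewrite /=; nra.
have := M0; nra.
Qed.

(* Turan's bound, from d(x) + d(y) <= n + c(x,y) summed over arcs. *)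
Lemma num_arcs_le : 3 * num_arcs <= 2 * n ^+ 2.
Proof.
have [n0|n0] := eqVneq #|V| 0%N.
  rewrite /num_arcs big_pred0 => [|x]; last by have := fintype0 x n0.
  by rewrite n0; nra.
have np : 0 < n by rewrite ltr0n lt0n.
have htri := num_triangles_le np codegreeD_le.
pose S : R := \sum_x degree x ^+ 2.
have up : 2 * S <= n * num_arcs + num_triangles.
  have -> : 2 * S = \sum_x \sum_y (g x y)%:R * degree x +
                    \sum_x \sum_y (g x y)%:R * degree y.
    rewrite [X in _ + X]exchange_big /= -big_split mulr_sumr.
    apply: eq_bigr => x _; rewrite -!mulr_suml expr2 /=.
    rewrite [X in _ + X * _](_ : _ = degree x); last first.
      by apply: eq_bigr => y _; rewrite gC.
    rewrite -/(degree x) /=; ring.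
  rewrite num_triangles_codegree -big_split mulr_sumr -big_split.
  apply: ler_sum => x _ /=; rewrite -big_split mulr_sumr -big_split.
  apply: ler_sum => y _ /=; have := degreeD_le x y.
  by case: (g x y); rewrite /=; lra.
(* Tangent line of the square at 2n/3, the degree in a balanced complete tripartite graph. *)
have low : 2 * (2 / 3 * n) * num_arcs - (2 / 3 * n) ^+ 2 * n <= S.
  rewrite -{3}sum1_card_natr !mulr_sumr -sumrB; apply: ler_sum => x _.
  have := sqr_ge0 (degree x - 2 / 3 * n).
  by rewrite -/(degree x); nra.
by nra.
Qed.

(** Otherwise [num_triangles_le] with M = (1 - eta) n, combined with Turan's bound, contradicts the
    triangle count. *)
Lemma exists_triangle_codegreeD (eta : R) : 0 < n -> 0 <= eta < 1 ->
  2 / 9 * (1 - eta) * n ^+ 3 < num_triangles ->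
  exists x y z, triangle g x y z /\
    (1 - eta) * n < codegree x y + codegree x z + codegree y z.
Proof.
move=> n0 eta01 hT.
have [/existsP[x /existsP[y /existsP[z /andP[t h]]]]|no] :=
    boolP [exists x, exists y, exists z, triangle g x y z &&
      ((1 - eta) * n < codegree x y + codegree x z + codegree y z)].
  by exists x, y, z.
have M0 : 0 < (1 - eta) * n by nra.
have := @num_triangles_le _ M0; have := num_arcs_le.
suff hM x y z : triangle g x y z ->
    codegree x y + codegree x z + codegree y z <= (1 - eta) * n.
  by move=> h1 /(_ hM) h2; nra.
move=> t; rewrite leNgt; apply: contra no => h.
by apply/existsP; exists x; apply/existsP; exists y; apply/existsP; exists z;
  rewrite t h.
Qed.
End TriangleCount.

(** * Transversal triangles of three disjoint vertex sets *)

Section NearTripartite.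
Variables (R : realFieldType) (V : finType).
Implicit Types (P A B C : pred V) (g : rel V).
Local Notation n := (@GRing.one R *+ #|V|).

Definition psize P : R := \sum_x (P x)%:R.

Definition num_transversals g P1 P2 P3 : R :=
  \sum_x \sum_y \sum_z [&& P1 x, P2 y, P3 z & triangle g x y z]%:R.

Definition disjoint3 P1 P2 P3 := forall x, (P1 x + P2 x + P3 x <= 1)%N.

Lemma psize_ge0 P : 0 <= psize P.
Proof. by apply: sumr_ge0 => x _; rewrite ler0n. Qed.

Lemma psize_le P : psize P <= n.
Proof.
by rewrite -sum1_card_natr; apply: ler_sum => x _; case: (P x); rewrite ?ler01.
Qed.

Lemma disjoint3_psize P1 P2 P3 : disjoint3 P1 P2 P3 ->
  psize P1 + psize P2 + psize P3 <= n.
Proof.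
move=> dis; rewrite -sum1_card_natr -!big_split; apply: ler_sum => x _ /=.
by have := dis x; rewrite -!natrD (ler_nat _ _ 1).
Qed.

Lemma psize3 P1 P2 P3 :
  psize P1 * psize P2 * psize P3 =
  \sum_x \sum_y \sum_z [&& P1 x, P2 y & P3 z]%:R.
Proof.
rewrite -mulrA big_distrl; apply: eq_bigr => x _ /=.
rewrite big_distrl big_distrr; apply: eq_bigr => y _ /=.
rewrite !big_distrr; apply: eq_bigr => z _ /=.
by rewrite -!natrM !mulnb.
Qed.

Lemma num_transversalsC12 g P1 P2 P3 : symmetric g ->
  num_transversals g P1 P2 P3 = num_transversals g P2 P1 P3.
Proof.
move=> gC; rewrite /num_transversals exchange_big.
apply: eq_bigr => x _; apply: eq_bigr => y _; apply: eq_bigr => z _.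
rewrite /triangle (gC y x); case: (P1 y); case: (P2 x); case: (P3 z) => //=.
by rewrite (andbC (g y z)).
Qed.

Lemma num_transversalsC23 g P1 P2 P3 : symmetric g ->
  num_transversals g P1 P2 P3 = num_transversals g P1 P3 P2.
Proof.
move=> gC; rewrite /num_transversals; apply: eq_bigr => x _.
rewrite exchange_big; apply: eq_bigr => y _; apply: eq_bigr => z _.
rewrite /triangle (gC z y); case: (P1 x); case: (P2 z); case: (P3 y) => //=.
by rewrite andbCA.
Qed.

(** The triples of A x B x C and the transversal triangles are disjoint families inside P1 x P2 x
    P3. *)
Lemma box_le g P1 P2 P3 A B C :
  subpred A P1 -> subpred B P2 -> subpred C P3 ->
  (forall x y z, A x -> B y -> C z -> triangle g x y z -> False) ->
  psize A * psize B * psize C + num_transversals g P1 P2 P3 <=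
  psize P1 * psize P2 * psize P3.
Proof.
move=> sA sB sC no; rewrite !psize3 /num_transversals.
rewrite -big_split; apply: ler_sum => x _ /=.
rewrite -big_split; apply: ler_sum => y _ /=.
rewrite -big_split; apply: ler_sum => z _ /=.
rewrite -natrD ler_nat.
have := no x y z; have := sA x; have := sB y; have := sC z.
case: (A x) => [|_ _ _ _];
  last by case: (P1 x); case: (P2 y); case: (P3 z); case: triangle.
case: (B y) => [|_ _ _ _];
  last by case: (P1 x); case: (P2 y); case: (P3 z); case: triangle.
case: (C z) => [|_ _ _ _];
  last by case: (P1 x); case: (P2 y); case: (P3 z); case: triangle.
move=> -> // -> // -> // h /=; case: triangle h => // h.
by case: (h isT isT isT isT).
Qed.

(** A triangle within the parts meets each independent part once, in one of six orders; any other
    triangle has one of its three positions outside the parts. *)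
Lemma num_triangles_le_transversals g P1 P2 P3 : symmetric g ->
  disjoint3 P1 P2 P3 ->
  (forall x y, P1 x -> P1 y -> ~~ g x y) ->
  (forall x y, P2 x -> P2 y -> ~~ g x y) ->
  (forall x y, P3 x -> P3 y -> ~~ g x y) ->
  num_triangles R g <= 6 * num_transversals g P1 P2 P3 +
    3 * (n - (psize P1 + psize P2 + psize P3)) * n ^+ 2.
Proof.
move=> gC dis i1 i2 i3.
(* By disjointness, the indicator of the vertices outside all parts. *)
pose rest x : R := 1 - (P1 x)%:R - (P2 x)%:R - (P3 x)%:R.
have restE : \sum_x rest x = n - (psize P1 + psize P2 + psize P3).
  by rewrite /rest !sumrB sum1_card_natr -/(psize _); rewrite /psize; lra.
set X := _ - _ in restE *.
pose tr := num_transversals g.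
have -> : 6 * tr P1 P2 P3 = tr P1 P2 P3 + tr P1 P3 P2 + tr P2 P1 P3 +
    tr P2 P3 P1 + tr P3 P1 P2 + tr P3 P2 P1.
  rewrite /tr (num_transversalsC23 P1 P3 P2 gC).
  rewrite (num_transversalsC23 P2 P3 P1 gC) (num_transversalsC12 P2 P1 P3 gC).
  rewrite (num_transversalsC23 P3 P2 P1 gC) (num_transversalsC12 P3 P1 P2 gC).
  by rewrite (num_transversalsC23 P1 P3 P2 gC); ring.
have -> : 3 * X * n ^+ 2 = \sum_(x : V) \sum_(y : V) \sum_(z : V) rest x +
   \sum_(x : V) \sum_(y : V) \sum_(z : V) rest y +
   \sum_(x : V) \sum_(y : V) \sum_(z : V) rest z.
  have c1 (f : V -> R) : \sum_x \sum_(y : V) f x = (\sum_x f x) * n.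
    by rewrite mulr_suml; apply: eq_bigr => x _; rewrite sumr_const mulr_natr.
  have c2 (c : R) : \sum_(x : V) c = c * n by rewrite sumr_const mulr_natr.
  under [X in _ = X + _ + _]eq_bigr do rewrite c1 c2.
  under [X in _ = _ + X + _]eq_bigr do rewrite c1 restE.
  under [X in _ = _ + _ + X]eq_bigr do rewrite c2 restE.
  by rewrite !c2 -!mulr_suml restE; ring.
rewrite -!big_split; apply: ler_sum => x _ /=.
rewrite -!big_split; apply: ler_sum => y _ /=.
rewrite -!big_split; apply: ler_sum => z _ /=.
have rest_ge0 v : 0 <= rest v.
  have := dis v; rewrite /rest.
  by case: (P1 v); case: (P2 v); case: (P3 v) => //= _; lra.
have := rest_ge0 x; have := rest_ge0 y; have := rest_ge0 z.
case t: (triangle g x y z); last by rewrite !andbF /=; lra.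
move: t => /and3P[gxy gxz gyz]; rewrite /rest.
have ind P : (forall u v, P u -> P v -> ~~ g u v) ->
    [&& ~~ (P x && P y), ~~ (P x && P z) & ~~ (P y && P z)].
  move=> iP; apply/and3P.
  by split; apply/negP => /andP[h1 /(iP _ _ h1)]; rewrite (gxy, gxz, gyz).
move: (dis x) (dis y) (dis z) (ind _ i1) (ind _ i2) (ind _ i3).
case: (P1 x); case: (P2 x); case: (P3 x) => //= _;
case: (P1 y); case: (P2 y); case: (P3 y) => //= _;
case: (P1 z); case: (P2 z); case: (P3 z) => //= *; lra.
Qed.

End NearTripartite.

(** * Stability: the shadow of a near-extremal configuration *)

Section Stability.
Variables (R : realFieldType) (V : finType) (g G : rel V) (mu : R).
Local Notation n := (@GRing.one R *+ #|V|).
Implicit Types (P A B C : pred V).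

(* Both graphs of the argument appear here: [G] is the shadow, [g] the graph of
   the pairs lying in at least two edges. *)
Definition near_extremal P1 P2 P3 :=
  [/\ disjoint3 P1 P2 P3,
      (1 - mu) * n <= psize R P1 + psize R P2 + psize R P3 &
      (1 / 27 - mu) * n ^+ 3 <= num_transversals R g P1 P2 P3].

Hypothesis gC : symmetric g.
Hypothesis GC : symmetric G.
Hypothesis gG : subrel g G.
Hypothesis noK4 : forall v x y z,
  G v x -> G v y -> G v z -> triangle g x y z -> False.
Hypothesis common_star : forall u v, G u v -> exists w, forall x y,
  G u x -> G v x -> G u y -> G v y -> g x y -> x = w \/ y = w.

(** Together with the next transposition this reaches every order of the parts, so later bounds are
    proved for P1 only. *)
Lemma near_extremalC12 P1 P2 P3 :
  near_extremal P1 P2 P3 -> near_extremal P2 P1 P3.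
Proof.
case=> dis h1 h2; split; first by move=> x; rewrite (addnC (P2 x)).
  by rewrite (addrC (psize R P2)).
by rewrite (num_transversalsC12 _ P2 P1 P3 gC).
Qed.

Lemma near_extremalC23 P1 P2 P3 :
  near_extremal P1 P2 P3 -> near_extremal P1 P3 P2.
Proof.
case=> dis h1 h2; split; first by move=> x; rewrite addnAC.
  by rewrite addrAC.
by rewrite (num_transversalsC23 _ P1 P3 P2 gC).
Qed.

(** The parts are the pairwise common neighbourhoods of a triangle with large codegree sum. Passing
    to transversals loses at most (1/27 + 1/2) mu n^3. *)
Lemma exists_near_extremal : 0 < n -> 0 <= mu < 1 ->
  2 / 9 * (1 - mu) * n ^+ 3 < num_triangles R g ->
  exists P1 P2 P3, near_extremal P1 P2 P3.
Proof.
move=> n0 mu01 hT.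
have gK4 v x y z : g v x -> g v y -> g v z -> triangle g x y z -> False.
  by move=> /gG h1 /gG h2 /gG h3; apply: noK4 h1 h2 h3.
have [x [y [z [/and3P[gxy gxz gyz] hs]]]] :=
  exists_triangle_codegreeD gC gK4 n0 mu01 hT.
pose N a b : pred V := fun v => g a v && g b v.
have ind a b : g a b -> forall u v, N a b u -> N a b v -> ~~ g u v.
  move=> gab u v /andP[au bu] /andP[av bv]; apply/negP => uv.
  by apply: (gK4 a b u v) => //; apply/and3P.
have dis : disjoint3 (N x y) (N x z) (N y z).
  move=> v; rewrite /N; have := gK4 v x y z; rewrite ![g v _]gC /triangle.
  rewrite gxy gxz gyz.
  by case: (g x v); case: (g y v); case: (g z v) => //= /(_ isT isT isT isT).
exists (N x y), (N x z), (N y z); split=> //; first exact: ltW.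
have := num_triangles_le_transversals R gC dis (ind _ _ gxy) (ind _ _ gxz)
  (ind _ _ gyz).
have Ecod a b : psize R (N a b) = codegree R g a b by [].
rewrite !Ecod.
set S := _ + codegree _ _ y z in hs *.
have : n - S <= mu * n by lra.
have n2 : 0 <= n ^+ 2 by apply: sqr_ge0.
move=> /(ler_wpM2r n2); rewrite exprS in hT *.
set T := num_triangles _ _ in hT *.
have : 0 <= mu * (n * n ^+ 2) by case/andP: mu01 => *; rewrite !mulr_ge0.
lra.
Qed.

(** One condition for all numerical estimates below; n >= 1000 also absorbs the star centre
    discarded in [no_inner_edge]. *)
Hypothesis small : [/\ 0 <= mu, mu * 1000 * 1000 <= 1 & 1000 <= n].

(** * Sizes of the parts *)

Section Parts.
Variables P1 P2 P3 : pred V.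
Hypothesis ext : near_extremal P1 P2 P3.
Local Notation n1 := (psize R P1).
Local Notation n2 := (psize R P2).
Local Notation n3 := (psize R P3).

Lemma num_transversals_le_psize :
  num_transversals R g P1 P2 P3 <= n1 * n2 * n3.
Proof.
have no x y z : pred0 x -> P2 y -> P3 z -> triangle g x y z -> False by [].
have := @box_le R V g P1 P2 P3 pred0 P2 P3 _ _ _ no.
by rewrite /(psize _ pred0) big1 // !mul0r add0r; apply.
Qed.

Lemma psizeM_le : 4 * (n2 * n3) <= (n - n1) ^+ 2.
Proof.
have [dis _ _] := ext; have hs := disjoint3_psize R dis.
have p2 := psize_ge0 R P2; have p3 := psize_ge0 R P3.
by have := sqr_ge0 (n2 - n3); nra.
Qed.

(* Equality up to the AM-GM loss on n2 * n3:
   4/27 n^3 - x (n - x)^2 = (x - n/3)^2 (4n/3 - x). *)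
Lemma psize1_key :
  (n1 - n / 3) ^+ 2 * (4 * n / 3 - n1) <= 4 / 27 * n ^+ 3 - 4 * (n1 * n2 * n3).
Proof.
have := ler_wpM2l (psize_ge0 R P1) psizeM_le.
lra.
Qed.

Lemma psize3_le : n1 * n2 * n3 <= n ^+ 3 / 27.
Proof.
have n1n := psize_le R P1; have [mu0 mu1 n_ge] := small.
have : 0 <= (n1 - n / 3) ^+ 2 * (4 * n / 3 - n1).
  by apply: mulr_ge0; [exact: sqr_ge0 | lra].
by have := psize1_key; lra.

Qed.

(** The left side of [psize1_key] is at most 4 mu n^3 <= 4 * 10^-6 n^3, while a larger part would
    make it exceed (11/3000)^2 / 3 n^3, about 4.48 * 10^-6 n^3. *)
Lemma psize1_le : n1 <= 337 / 1000 * n.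
Proof.
have [dis h1 h2] := ext; have n1n := psize_le R P1.
have key : (n1 - n / 3) ^+ 2 * (4 * n / 3 - n1) <= 4 * mu * n ^+ 3.
  by have := psize1_key; have := num_transversals_le_psize; lra.
rewrite leNgt; apply/negP => big; have [_ mu_le _] := small.
have n0 : 0 < n by lra.
(* 11 / 3000 = 337 / 1000 - 1 / 3 *)
have a1 : (11 / 3000 * n) ^+ 2 <= (n1 - n / 3) ^+ 2.
  by rewrite ler_sqr ?nnegrE; lra.
have a2 : n / 3 <= 4 * n / 3 - n1 by lra.
have a3 : (11 / 3000 * n) ^+ 2 * (n / 3) <= 4 * mu * n ^+ 3.
  by apply: le_trans key; apply: ler_pM => //; [apply: sqr_ge0 | lra].
have n3p : 0 < n ^+ 3 by rewrite exprn_gt0.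
have : mu * 1000 * 1000 * n ^+ 3 <= n ^+ 3.
  by rewrite -[leRHS]mul1r ler_wpM2r // ltW.
rewrite (_ : _ * _ = (11 / 3000) ^+ 2 / 3 * n ^+ 3) in a3; last by field.
lra.
Qed.

(** The box must fit between the transversal count and the maximum n^3/27 of n1 n2 n3. *)
Lemma box_small A B C :
  subpred A P1 -> subpred B P2 -> subpred C P3 ->
  (forall x y z, A x -> B y -> C z -> triangle g x y z -> False) ->
  psize R A * psize R B * psize R C <= mu * n ^+ 3.
Proof.
move=> sA sB sC no; have := box_le R sA sB sC no.
by have [_ _] := ext; have := psize3_le; lra.
Qed.

End Parts.

(** Lower bounds come from the total size: 1 - 0.001 - 2 * 0.337 = 0.325. *)
Lemma psize_bounds P1 P2 P3 : near_extremal P1 P2 P3 ->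
  [/\ psize R P1 <= 337 / 1000 * n, psize R P2 <= 337 / 1000 * n,
      psize R P3 <= 337 / 1000 * n & 325 / 1000 * n <= psize R P1 /\
      325 / 1000 * n <= psize R P2 /\ 325 / 1000 * n <= psize R P3].
Proof.
move=> ext; have h1 := psize1_le ext.
have h2 := psize1_le (near_extremalC12 ext).
have h3 := psize1_le (near_extremalC12 (near_extremalC23 ext)).
have [_ h _] := ext.
have [mu0 mu1 n_ge] := small.
have : mu * n * 1000 <= n by move: n_ge mu0 mu1; clear_ineqs; nra.
by move: h h1 h2 h3; clear_ineqs; split=> //; split; [|split]; lra.
Qed.

(** The threshold is below 2/3, the relative degree in the balanced tripartite graph, so vertices
    failing it cost arcs. *)
Definition high v := 16 / 25 * n <= degree R G v.

(** A low vertex of P1 lies in at most (0.64 n)^2 / 4 = 0.1024 n^2 transversals, but n2 n3 >= (0.325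
    n)^2 > 0.1056 n^2. So it misses over 0.003 n^2 of them, out of a total slack of mu n^3. *)
Lemma low_count P1 P2 P3 : near_extremal P1 P2 P3 ->
  psize R [pred v | P1 v && ~~ high v] * (3 / 1000) <= mu * n.
Proof.
move=> ext; have [s1 s2 s3 [t1 [t2 t3]]] := psize_bounds ext.
have [dis _ htau] := ext; have [mu0 mu1 n_ge] := small.
have n0 : 0 < n by move: n_ge; clear_ineqs; lra.
suff : psize R [pred v | P1 v && ~~ high v] * (3 / 1000 * n ^+ 2) +
    num_transversals R g P1 P2 P3 <= psize R P1 * psize R P2 * psize R P3.
  have := psize3_le ext; set b := psize R (SimplPred _) => h1 h2.
  have n2 : 0 < n ^+ 2 by rewrite exprn_gt0.
  have n3 : n ^+ 3 = n * n ^+ 2 by rewrite exprS.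
  by rewrite -(ler_pM2r n2); move: h1 h2 n3 htau; clear_ineqs; lra.
rewrite -[X in _ <= X]mulrA ![psize R _ * (_ * _)]mulr_suml.
rewrite -big_split; apply: ler_sum => x _ /=.
case P1x: (P1 x) => /=; last first.
  by rewrite big1 ?mul0r ?addr0 // => y _; rewrite big1.
pose d (P : pred V) := psize R [pred y | P y && g x y].
have dP (P : pred V) : 0 <= d P <= psize R P.
  rewrite psize_ge0; apply: ler_sum => y _ /=.
  by rewrite ler_nat; case: (P y); case: (g x y).
have le_d : \sum_y \sum_z [&& P2 y, P3 z & triangle g x y z]%:R <= d P2 * d P3.
  rewrite /d /psize mulr_suml; apply: ler_sum => y _.
  rewrite mulr_sumr; apply: ler_sum => z _ /=.
  rewrite -natrM mulnb ler_nat /triangle.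
  by case: (P2 y); case: (P3 z); case: (g x y); case: (g x z); case: (g y z).
have := dP P2; have := dP P3 => /andP[d3 e3] /andP[d2 e2].
rewrite !mul1r; apply: le_trans (lerD (lexx _) le_d) _.
have [hi|lo] := boolP (high x); first by rewrite mul0r add0r; apply: ler_pM.
rewrite /high -ltNge in lo; rewrite mul1r.
have dd : d P2 + d P3 <= degree R G x.
  rewrite /d /psize -big_split; apply: ler_sum => y _ /=.
  rewrite -natrD ler_nat; have := dis y; have := @gG x y.
  by case: (P2 y); case: (P3 y); case: (P1 y); case: (g x y);
    case: (G x y) => //= /(_ isT).
have ds : d P2 + d P3 <= 16 / 25 * n := le_trans dd (ltW lo).
have up : 4 * (d P2 * d P3) <= (16 / 25 * n) ^+ 2.
  apply: (@le_trans _ _ ((d P2 + d P3) ^+ 2)).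
    by have := sqr_ge0 (d P2 - d P3); clear_ineqs; lra.
  by rewrite ler_sqr // nnegrE; [exact: addr_ge0 | move: n0; clear_ineqs; lra].
have n_ge0 : 0 <= 325 / 1000 * n by move: n0; clear_ineqs; lra.
have := ler_pM n_ge0 n_ge0 t2 t3; have : 0 < n ^+ 2 by rewrite exprn_gt0.
by move: up; clear_ineqs; lra.
Qed.


Definition nbr_in P v : R := psize R [pred x | P x && G v x].

(** The neighbours of v in the three parts span a box without heavy triangles, of size at most mu
    n^3 <= (n/100)^3. *)
Lemma few_nbrs_in_some_part P1 P2 P3 v : near_extremal P1 P2 P3 ->
  [|| nbr_in P1 v <= n / 100, nbr_in P2 v <= n / 100 | nbr_in P3 v <= n / 100].
Proof.
move=> ext; rewrite -[_ || _]negbK !negb_or -!ltNge.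
apply/negP => /and3P[l1 l2 l3]; have [mu0 mu1 n_ge] := small.
have n100 : 0 <= n / 100 by lra.
have : nbr_in P1 v * nbr_in P2 v * nbr_in P3 v <= mu * n ^+ 3.
  apply: (box_small ext); try by move=> x /andP[].
  by move=> x y z /andP[_ vx] /andP[_ vy] /andP[_ vz]; apply: noK4 vx vy vz.
apply/negP; rewrite -ltNge.
apply: (@le_lt_trans _ _ ((n / 100) * (n / 100) * (n / 100))); last first.
  by apply: ltr_pM => //; [rewrite mulr_ge0 | apply: ltr_pM].
have n3 : 0 <= n ^+ 3 by rewrite exprn_ge0; lra.
have := ler_wpM2r n3 mu1; lra.
Qed.

Lemma degree_le P1 P2 P3 v : near_extremal P1 P2 P3 ->
  degree R G v <= nbr_in P1 v + nbr_in P2 v + nbr_in P3 v + mu * n.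
Proof.
case=> dis hs _.
suff : degree R G v <= nbr_in P1 v + nbr_in P2 v + nbr_in P3 v +
    (n - psize R P1 - psize R P2 - psize R P3) by lra.
rewrite /nbr_in /psize -sum1_card_natr -!sumrB -!big_split.
apply: ler_sum => x _ /=; have := dis x.
by case: (P1 x); case: (P2 x); case: (P3 x); case: (G v x) => //= _; lra.
Qed.

(* An edge uv inside a part would have almost all of the two other parts as
   common neighbours, and the heavy pairs there do not form a star. *)
Lemma no_inner_edge P1 P2 P3 u v : near_extremal P1 P2 P3 ->
  high u -> high v -> nbr_in P1 u <= n / 100 -> nbr_in P1 v <= n / 100 ->
  ~~ G u v.
Proof.
move=> ext hu hv fu fv; apply/negP => /common_star[w star_w].
have [s1 s2 s3 [t1 [t2 t3]]] := psize_bounds ext.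
have [mu0 mu1 n_ge] := small.
have mun : mu * n * 1000 <= n by move: n_ge mu1 mu0; clear_ineqs; nra.
pose C P := [pred x | [&& P x, G u x, G v x & x != w]].
have CE (P : pred V) : nbr_in P u + nbr_in P v <= psize R P + 1 + psize R (C P).
  rewrite (_ : 1 = \sum_x (x == w)%:R); last first.
    by rewrite (bigD1 w) //= eqxx big1 ?addr0 // => x /negPf->.
  rewrite /nbr_in /psize -!big_split; apply: ler_sum => x _ /=.
  rewrite -!natrD ler_nat.
  by case: (P x); case: (G u x); case: (G v x); case: (x == w).
have part_le (P : pred V) x : nbr_in P x <= psize R P.
  apply: ler_sum => y _ /=; rewrite ler_nat.
  by case: (P y); case: (G x y).
have du := degree_le u ext; have dv := degree_le v ext.
rewrite /high in hu hv.
have := part_le P2 u; have := part_le P2 v.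
have := part_le P3 u; have := part_le P3 v; have := CE P2; have := CE P3.
move=> c3 c2 p1 p2 p3 p4.
(* Each of u, v has at least (0.64 - 0.01 - 0.337 - 0.001) n = 0.292 n neighbours in P2, which has
   at most 0.337 n vertices; at least 0.246 n are common even without w. *)
have b2 : 24 / 100 * n <= psize R (C P2).
  by move: hu hv fu fv du dv s2 s3 p1 p2 n_ge mun c2; clear_ineqs; lra.
have b3 : 24 / 100 * n <= psize R (C P3).
  by move: hu hv fu fv du dv s2 s3 p3 p4 n_ge mun c3; clear_ineqs; lra.
clear du dv CE part_le c2 c3 p1 p2 p3 p4.
have : psize R P1 * psize R (C P2) * psize R (C P3) <= mu * n ^+ 3.
  apply: (box_small ext) => //; try by move=> x /andP[].
  move=> x y z _ /and4P[_ uy vy yw] /and4P[_ uz vz zw] /and3P[_ _ yz].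
  by have [E|E] := star_w y z uy vy uz vz yz; rewrite E eqxx in yw zw.
apply/negP; rewrite -ltNge.
apply: (@lt_le_trans _ _ ((325 / 1000 * n) * (24 / 100 * n) * (24 / 100 * n))).
  have n3 : 0 < n ^+ 3 by rewrite exprn_gt0; move: n_ge; clear_ineqs; lra.
  by have := ler_wpM2r (ltW n3) mu1; move: n3; clear_ineqs; lra.
have nn1 : 0 <= 325 / 1000 * n by move: n_ge; clear_ineqs; lra.
have nn2 : 0 <= 24 / 100 * n by move: n_ge; clear_ineqs; lra.
by apply: ler_pM => //; [rewrite mulr_ge0 | apply: ler_pM].
Qed.

(** The b low vertices add at most 1.28 b n arcs, while leaving them out lowers the tripartite bound
    by about 4/3 b n. *)
Lemma num_arcs_le_near_extremal P1 P2 P3 : near_extremal P1 P2 P3 ->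
  3 * num_arcs R G <= 2 * n ^+ 2.
Proof.
move=> ext; have [mu0 mu1 n_ge] := small.
pose W := [pred v | high v]; pose B := [pred v | ~~ high v].
(* Each high vertex goes to the first part where it has few neighbours; those left for Q3 have few
   in P3 by [few_nbrs_in_some_part]. *)
pose Q1 v := high v && (nbr_in P1 v <= n / 100).
pose Q2 v := [&& high v, ~~ (nbr_in P1 v <= n / 100) & nbr_in P2 v <= n / 100].
pose Q3 v := [&& high v, ~~ (nbr_in P1 v <= n / 100) &
                 ~~ (nbr_in P2 v <= n / 100)].
have i1 u v : Q1 u -> Q1 v -> ~~ G u v.
  by move=> /andP[hu fu] /andP[hv fv]; apply: (no_inner_edge ext).
have i2 u v : Q2 u -> Q2 v -> ~~ G u v.
  move=> /and3P[hu _ fu] /and3P[hv _ fv].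
  exact: (no_inner_edge (near_extremalC12 ext)).
have i3 u v : Q3 u -> Q3 v -> ~~ G u v.
  move=> /and3P[hu n1u n2u] /and3P[hv n1v n2v].
  apply: (no_inner_edge (near_extremalC12 (near_extremalC23 ext))) => //.
    by have := few_nbrs_in_some_part u ext; rewrite (negPf n1u) (negPf n2u).
  by have := few_nbrs_in_some_part v ext; rewrite (negPf n1v) (negPf n2v).
have QW : psize R Q1 + psize R Q2 + psize R Q3 = psize R W.
  rewrite /psize -!big_split; apply: eq_bigr => x _ /=.
  rewrite /Q1 /Q2 /Q3; case: (high x) => /=; last by rewrite !addr0.
  by case: (_ <= _); case: (_ <= _); rewrite /= ?addr0 ?add0r.
have BW : psize R W + psize R B = n.
  rewrite -sum1_card_natr -big_split; apply: eq_bigr => x _ /=.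
  by case: (high x); rewrite /= ?addr0 ?add0r.
have inner : \sum_u \sum_v [&& W u, W v & G u v]%:R <=
    psize R W ^+ 2 - psize R Q1 ^+ 2 - psize R Q2 ^+ 2 - psize R Q3 ^+ 2.
  rewrite !expr2 /psize !mulr_suml -!sumrB; apply: ler_sum => u _.
  rewrite !mulr_sumr -!sumrB; apply: ler_sum => v _ /=.
  have := i1 u v; have := i2 u v; have := i3 u v.
  rewrite /Q1 /Q2 /Q3.
  case: (high u); case: (high v); rewrite /= ?mulr0 ?mul0r ?subr0 //.
  case: (nbr_in P1 u <= _); case: (nbr_in P2 u <= _);
  case: (nbr_in P1 v <= _); case: (nbr_in P2 v <= _);
  case: (G u v) => //= h1 h2 h3; first
    [ by case: (h1 isT isT) | by case: (h2 isT isT) | by case: (h3 isT isT)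
    | clear_ineqs; lra].
(* An arc not inside W starts or ends at a low vertex. *)
have outer : num_arcs R G <= \sum_u \sum_v [&& W u, W v & G u v]%:R +
    2 * (psize R B * (16 / 25 * n)).
  have Bdeg : \sum_u \sum_v (B u && G u v)%:R <= psize R B * (16 / 25 * n).
    rewrite /psize mulr_suml; apply: ler_sum => u _ /=.
    have [hu|lu] := boolP (high u); first by rewrite big1 ?mul0r.
    by rewrite mul1r ltW // -/(degree _ _ _); rewrite /high -ltNge in lu.
  apply: (@le_trans _ _ (\sum_u \sum_v [&& W u, W v & G u v]%:R +
     (\sum_u \sum_v (B u && G u v)%:R + \sum_v \sum_u (B v && G v u)%:R))).
    rewrite [X in _ + (_ + X)]exchange_big -!big_split; apply: ler_sum => u _ /=.
    rewrite -!big_split; apply: ler_sum => v _ /=; rewrite (GC v u).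
    clear_ineqs.
    by case: (high u); case: (high v); case: (G u v); rewrite /=; lra.
  by rewrite lerD2l; lra.
(* Each part has at most (1000/3) mu n low vertices, and at most mu n vertices lie outside the
   parts. *)
have B_small : psize R B <= n / 25.
  have l1 := low_count ext; have l2 := low_count (near_extremalC12 ext).
  have l3 := low_count (near_extremalC12 (near_extremalC23 ext)).
  have [dis hs _] := ext.
  have mun : mu * n * 1000 * 1000 <= n by nra.
  suff : psize R B <= psize R [pred v | P1 v && ~~ high v] +
      psize R [pred v | P2 v && ~~ high v] +
      psize R [pred v | P3 v && ~~ high v] +
      (n - psize R P1 - psize R P2 - psize R P3) by lra.
  rewrite /psize -sum1_card_natr -!sumrB -!big_split; apply: ler_sum => x _ /=.
  have := dis x; clear_ineqs.
  by case: (high x); case: (P1 x); case: (P2 x); case: (P3 x) => //= _; lra.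
have B0 := psize_ge0 R B.
set q1 := psize R Q1 in QW inner; set q2 := psize R Q2 in QW inner.
set q3 := psize R Q3 in QW inner; set b := psize R B in BW B_small B0 outer.
have sq : psize R W ^+ 2 <= 3 * (q1 ^+ 2 + q2 ^+ 2 + q3 ^+ 2).
  rewrite -QW; have := sqr_ge0 (q1 - q2); have := sqr_ge0 (q1 - q3).
  by have := sqr_ge0 (q2 - q3); lra.
have W_eq : psize R W = n - b by lra.
rewrite W_eq in sq inner.
(* What remains is 2/3 (n - b)^2 + 32/25 b n <= 2/3 n^2, true for 0 <= b <= 2n/25. *)
have : 0 <= b * (n / 25 - b) by rewrite mulr_ge0 //; lra.
by nra.
Qed.

End Stability.

(** * From many edges to the bound on the shadow *)

Lemma num_arcs_card (R : realFieldType) (V : finType) (g : rel V) :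
  num_arcs R g = #|[set p | g p.1 p.2]|%:R.
Proof.
rewrite /num_arcs pair_bigA -sum1_card natr_sum [RHS]big_mkcond /=.
by apply: eq_bigr => p _; rewrite inE; case: (g _ _).
Qed.

Lemma num_triangles_card (R : realFieldType) (V : finType) (g : rel V) :
  num_triangles R g = #|[set p | triangle g p.1.1 p.1.2 p.2]|%:R.
Proof.
rewrite /num_triangles pair_bigA pair_bigA -sum1_card natr_sum.
rewrite [RHS]big_mkcond /=.
by apply: eq_bigr => p _; rewrite inE; case: (triangle _ _ _ _).
Qed.

(** Both the missing edges and the n^2 edges with a non-heavy pair cost at most mu n^3 / 60. Six
    times their sum is mu n^3 / 5, less than the 2/9 mu n^3 allowed by [exists_near_extremal]. *)
Lemma D_free_dense_shadow (R : realFieldType) (mu : R) (V : finType)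
    (H : three_graph V) :
  D_free H -> 0 < mu -> mu * 1000 * 1000 <= 1 ->
  60 <= mu * #|V|%:R -> 1000 <= #|V|%:R :> R ->
  (1 / 27 - mu / 60) * #|V|%:R ^+ 3 < #|edges H|%:R ->
  #|shadow H|%:R <= 1 / 3 * #|V|%:R ^+ 2 :> R.
Proof.
move=> free mu0 mu1 nmu nbig dense.
have := card_edges_le H; rewrite -(ler_nat R) natrD !natrM.
rewrite -num_triangles_card => edges_le.
have := card_shadow_le H; rewrite -(ler_nat R) natrM -num_arcs_card => arcs_ge.
set n : R := #|V|%:R in nmu nbig dense edges_le *.
have n0 : 0 < n by lra.
have n2 : 0 < n ^+ 2 by rewrite exprn_gt0.
have nn : 60 * n ^+ 2 <= mu * n ^+ 3.
  by rewrite [n ^+ 3]exprS mulrA ler_wpM2r // ltW.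
have [||P1 [P2 [P3 ext]]] := exists_near_extremal (heavyC H)
  (@heavy_shadow _ H) (no_heavy_triangle free) n0 (mu := mu).
- by rewrite ltW //=; lra.
- by lra.
have := num_arcs_le_near_extremal (heavyC H) (@shadow_relC _ H) (@heavy_shadow _ H)
  (no_heavy_triangle free) (heavy_common_star free) _ ext.
rewrite -/n => /(_ (And3 (ltW mu0) mu1 nbig)); lra.
Qed.

Theorem theorem3p3 (R : realType) :
  exists delta0 : R, 0 < delta0 /\
    forall eps : R, 0 < eps -> eps < 10 ^- 8 ->
      exists n0 : nat, forall n : nat, (n0 <= n)%N ->
        forall (V : finType) (H : three_graph V),
          #|V| = n ->
          D_free H ->
          #|shadow H|%:R = (1 / 3 + eps) * n%:R ^+ 2 ->
          #|edges H|%:R <= (1 / 27 - delta0) * n%:R ^+ 3.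
Proof.
pose mu : R := (1000 * 1000)^-1.
have mu0 : 0 < mu by rewrite invr_gt0 mulr_gt0.
have mu1 : mu * (1000 * 1000) = 1 by rewrite mulVf // lt0r_neq0 // mulr_gt0.
exists (mu / 60); split=> [|eps eps0 _]; first by rewrite divr_gt0.
(* With mu = 10^-6, n > 6 * 10^7 ensures mu n >= 60. *)
exists (Num.bound (60 * 1000 * 1000 : R)) => n large V H Vn free.
rewrite -{}Vn in large * => hshadow; have n_gt : 60 * 1000 * 1000 < #|V|%:R :> R.
  apply: lt_le_trans (archi_boundP _) _; last by rewrite ler_nat.
  by rewrite !mulr_ge0.
rewrite leNgt; apply/negP => dense.
have mu_n : 60 <= mu * #|V|%:R.
  by have := ltW n_gt; rewrite -(ler_pM2l mu0); lra.
have mu_le : mu * 1000 * 1000 <= 1 by lra.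
have n_ge : 1000 <= #|V|%:R :> R by lra.
have := D_free_dense_shadow free mu0 mu_le mu_n n_ge dense.
(* The shadow exceeds n^2/3 by eps n^2 > 0. *)
apply/negP; rewrite hshadow -ltNge mulrDl ltrDl mulr_gt0 //.
by rewrite exprn_gt0 //; lra.
Qed.
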